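(* Let $r$ be an even positive integer and let $G$ be a finite $r$-regular graph (multiple edges allowed) on $n$ vertices which has the triangle property. Then $G$ contains at least $\frac{nr}{6}$ triangles.
   Context: Graphs may have multiple edges. A triangle in a graph is a set of three distinct vertices together with a choice of one edge joining each pair of them; thus if a pair of the three vertices is joined by a multiple edge, the same three vertices give rise to several distinct triangles, and a loop is never in a triangle. A graph has the triangle property if every edge of the graph lies in at least one triangle. *)

(* Defs.v *)
From mathcomp Require Import all_boot all_order all_algebra.

Set Implicit Arguments.
Unset Strict Implicit.
Unset Printing Implicit Defensive.

(* A finite multigraph: several edges may have the same ends, and an edge     *)
(* whose set of ends is a singleton is a loop.                                *)
Record mgraph := MGraph {
  vertex : finType;
  edge : finType;
  ends : edge -> {set vertex};
  card_ends : forall e : edge, 0 < #|ends e| <= 2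
}.

(* A loop contributes 2 to the degree. *)
Definition degree (G : mgraph) (v : vertex G) : nat :=
  #|[set e : edge G | v \in ends e]| + #|[set e : edge G | ends e == [set v]]|.

Definition regular (r : nat) (G : mgraph) : Prop :=
  forall v : vertex G, degree v = r.

(* The pair (S, T) represents the triangle with vertex set S and edge set T:  *)
(* every edge in T joins two distinct vertices of S, and for every pair of    *)
(* distinct vertices of S exactly one edge joining them is chosen in T.       *)
Definition is_triangle (G : mgraph) (t : {set vertex G} * {set edge G}) : bool :=
  [&& #|t.1| == 3,
      [forall e in t.2, (ends e \subset t.1) && (#|ends e| == 2)]
    & [forall x in t.1, forall y in t.1, (x != y) ==>
        (#|[set e in t.2 | ends e == [set x; y]]| == 1)]].

Definition triangles (G : mgraph) : {set {set vertex G} * {set edge G}} :=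
  [set t | is_triangle t].

Definition triangle_property (G : mgraph) : Prop :=
  forall e : edge G, exists2 t, t \in triangles G & e \in t.2.

(* Main.v *)
Require Import Defs.
From mathcomp Require Import all_boot all_order all_algebra.

Import GRing.Theory Num.Theory.
Local Open Scope ring_scope.

(** Double counting: an [r]-regular graph has [n r / 2] edges, they are covered
    by the triangles, and a triangle covers three of them. *)

(** Summing degrees counts every edge twice, so [n * r = 2 * #|edge G|] ([handshake]). By the
    triangle property the edge sets of the triangles cover all edges, and each has at most three
    elements ([card_triangle_edges]), so [#|edge G| <= 3 * #|triangles G|]
    ([card_edge_le_triangles]). Together, [n * r <= 6 * #|triangles G|]. *)

Lemma sum_card_rel {S T : finType} (R : S -> T -> bool) :
  (\sum_x #|[set y | R x y]| = \sum_y #|[set x | R x y]|)%N.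
Proof.
under eq_bigr => x _ do rewrite cardsE -sum1_card big_mkcond.
rewrite exchange_big /=; apply: eq_bigr => y _.
by rewrite cardsE -sum1_card [in RHS]big_mkcond.
Qed.

(** This is the share of [e] in the degree sum: 2 + 0 for an edge with distinct ends, 1 + 1 for a
    loop. *)
Lemma card_ends_loop (G : mgraph) (e : edge G) :
  (#|ends e| + #|[set v | ends e == [set v]]| = 2)%N.
Proof.
have /andP[e_gt0 e_le2] := card_ends e.
have [/eqP/cards1P[v ->]|e_neq1] := eqVneq #|ends e| 1%N.
  rewrite cards1 (_ : [set _ | _] = [set v]) ?cards1 //.
  by apply/setP => w; rewrite !inE (inj_eq set1_inj) eq_sym.
rewrite (_ : [set _ | _] = set0) ?cards0 ?addn0.
  by case: #|ends e| e_gt0 e_le2 e_neq1 => [|[|[|]]].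
apply/setP => w; rewrite !inE; apply: contra_neqF e_neq1 => /eqP ->.
by rewrite cards1.
Qed.

Lemma handshake (G : mgraph) : (\sum_(v : vertex G) degree v = 2 * #|edge G|)%N.
Proof.
rewrite big_split /= (sum_card_rel (fun v e => v \in ends e)).
rewrite (sum_card_rel (fun v e => ends e == [set v])) -big_split /=.
under eq_bigr => e _ do rewrite cardsE card_ends_loop.
by rewrite sum_nat_const mulnC.
Qed.

Lemma cards3_exists (T : finType) (S : {set T}) : #|S| = 3%N ->
  exists x y z, [/\ x != y, x != z, y != z & S = [set x; y; z]].
Proof.
move=> S3; have /card_gt0P[x Sx] : (0 < #|S|)%N by rewrite S3.
have /eqP/cards2P[y [z [yz Sx_yz]]] : #|S :\ x| = 2%N.
  by move: S3; rewrite (cardsD1 x) Sx => -[].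
have /setP/(_ x) := Sx_yz; rewrite !inE eqxx /= => /esym/norP[xy xz].
by exists x, y, z; split=> //; rewrite -setUA -Sx_yz setD1K.
Qed.

(** Each chosen edge joins one of the three pairs of vertices, and each pair has exactly one chosen
    edge. *)
Lemma card_triangle_edges (G : mgraph) (t : {set vertex G} * {set edge G}) :
  is_triangle t -> (#|t.2| <= 3)%N.
Proof.
case: t => S T /and3P[/= /eqP/cards3_exists[x [y [z [xy xz yz ->]]]]] /forall_inP ends_T.
move=> /forall_inP joinT.
pose join a b := [set e in T | ends e == [set a; b]].
have card_join a b : a \in [set x; y; z] -> b \in [set x; y; z] -> a != b ->
    #|join a b| = 1%N.
  by move=> Sa Sb ab; have /forall_inP/(_ b Sb)/implyP/(_ ab)/eqP := joinT a Sa.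
have /subset_leq_card/leq_trans -> // :
    T \subset join x y :|: join x z :|: join y z.
  apply/subsetP => e Te; have /andP[sub_e /cards2P[a [b [ab ends_e]]]] := ends_T e Te.
  move: sub_e; rewrite !inE Te ends_e subUset !sub1set !inE /=.
  have swap c d : ([set c; d] == [set d; c]) by rewrite setUC.
  (* Of the nine positions of [(a, b)], the three diagonal ones contradict [a != b]; the others
     match one of the three pairs up to order. *)
  by case/andP=> /orP[/orP[]|] /eqP aE /orP[/orP[]|] /eqP bE; move: ab;
    rewrite aE bE ?eqxx ?swap ?orbT.
apply: leq_trans (leq_card_setU _ _) _; rewrite (card_join y z) ?inE ?eqxx ?orbT //.
rewrite addn1 ltnS; apply: leq_trans (leq_card_setU _ _) _.
by rewrite !card_join ?inE ?eqxx ?orbT.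
Qed.

Lemma card_edge_le_triangles (G : mgraph) :
  triangle_property G -> (#|edge G| <= 3 * #|triangles G|)%N.
Proof.
move=> triG.
have /eqP cov : \bigcup_(t in triangles G) t.2 == [set: edge G].
  rewrite -subTset; apply/subsetP => e _.
  by have [t Gt te] := triG e; apply/bigcupP; exists t.
rewrite -cardsT -cov mulnC -sum_nat_const.
(* Union bound, by parallel induction on the union of the edge sets and the sum of the constant
   3. *)
elim/big_ind2: _ => [|m A k B le_m le_k|t]; first by rewrite cards0.
  exact: leq_trans (leq_card_setU _ _) (leq_add le_m le_k).
by rewrite inE => /card_triangle_edges.
Qed.

Theorem theorem1 (r n : nat) (G : mgraph)
    (r_pos : (0 < r)%N) (r_even : ~~ odd r)
    (order_G : #|vertex G| = n) (reg_G : regular r G)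
    (tri_G : triangle_property G) :
  (n%:R * r%:R / 6%:R : rat) <= #|triangles G|%:R.
Proof.
rewrite ler_pdivrMr // -!natrM ler_nat.
have /esym := handshake G; under eq_bigr => v _ do rewrite reg_G.
rewrite sum_nat_const order_G => <-.
(* The factor 2 of 6 cancels against the handshake identity; the factor 3 is the bound on the edges
   per triangle. *)
by rewrite -[6%N]/(3 * 2)%N mulnA (mulnC _ 3) mulnC leq_mul2r
  card_edge_le_triangles.
Qed.
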